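(* Let $K$ be an infinite field of characteristic different from $2$ and $3$. For a Bernstein algebra $A=Ke\oplus U\oplus V$ over $K$ with barideal $N=\ker(\omega)=U\oplus V$, the following conditions are equivalent: (i) the algebra $A$ is algebraic of bounded degree; (ii) the ideal $N$ is algebraic of bounded degree; (iii) the operators $L_v:U\to U$ are algebraic for all $v\in V$ and their algebraic degrees are bounded collectively.
   Context: Algebras are not assumed associative, unital or finite-dimensional. A Bernstein algebra over $K$ is a commutative $K$-algebra $A$ with a nonzero algebra homomorphism $\omega:A\to K$ (weight function) satisfying $(x^2)^2=\omega(x)^2x^2$ for all $x$. Here $e$ is a nonzero idempotent of $A$ (necessarily $\omega(e)=1$) and $A=Ke\oplus U\oplus V$ is the Peirce decomposition relative to $e$: $U=\{u\in A: 2eu=u\}$, $V=\{v\in A: ev=0\}$, $\ker\omega=U\oplus V$; one has $UV\subseteq U$, so that $L_v(u)=vu$ defines an operator $L_v:U\to U$ for $v\in V$. An element $a$ is algebraic of degree $\dim\mathrm{alg}(a)$ if the subalgebra $\mathrm{alg}(a)$ generated by $a$ is finite-dimensional; an algebra or ideal is algebraic of bounded degree if all its elements are algebraic with degrees bounded by a common integer. A linear operator $T$ is algebraic if $P(T)=0$ for some nonzero $P\in K[X]$; its degree is the least degree of such $P$. *)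

(* Defs.v *)
From HB Require Import structures.
From mathcomp Require Import all_boot all_order all_algebra sesquilinear.
From mathcomp Require Import boolp classical_sets functions cardinality.

Set Implicit Arguments.
Unset Strict Implicit.
Unset Printing Implicit Defensive.

Import GRing.Theory.
Local Open Scope ring_scope.
Local Open Scope classical_set_scope.

(* A not necessarily associative or unital K-algebra is an lmodType K (of
   arbitrary dimension) together with a bilinear map mul. *)

Section LinearAlgebra.
Variables (K : fieldType) (A : lmodType K).

Definition lin_indep (n : nat) (b : 'I_n -> A) : Prop :=
  forall c : 'I_n -> K, \sum_(i < n) c i *: b i = 0 -> forall i, c i = 0.

Definition lin_span (n : nat) (b : 'I_n -> A) : set A :=
  [set x | exists c : 'I_n -> K, x = \sum_(i < n) c i *: b i].

Definition has_dim (W : set A) (n : nat) : Prop :=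
  exists b : 'I_n -> A, lin_indep b /\ W = lin_span b.

Definition horner_op (P : {poly K}) (T : A -> A) (x : A) : A :=
  \sum_(i < size P) P`_i *: iter i T x.

(* For a subspace W stable under T, this says that P(T|_W) = 0.  It is used
   with T = mul v and W = U, which is stable because UV is contained in U. *)
Definition annihilates_on (W : set A) (T : A -> A) (P : {poly K}) : Prop :=
  forall x, W x -> horner_op P T x = 0.

Definition algebraic_op_on (W : set A) (T : A -> A) : Prop :=
  exists P : {poly K}, P != 0 /\ annihilates_on W T P.

Definition op_degree_on (W : set A) (T : A -> A) (n : nat) : Prop :=
  (exists P : {poly K},
     [/\ P != 0, annihilates_on W T P & (size P).-1 = n])
  /\ (forall P : {poly K},
        P != 0 -> annihilates_on W T P -> (n <= (size P).-1)%N).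

End LinearAlgebra.

Section Algebras.
Variables (K : fieldType) (A : lmodType K) (mul : {bilinear A -> A -> A}).

Definition subalgebra (B : set A) : Prop :=
  [/\ B 0,
      forall (k : K) x y, B x -> B y -> B (k *: x + y) &
      forall x y, B x -> B y -> B (mul x y)].

Definition alg (a : A) : set A := smallest subalgebra [set a].

Definition elt_degree (a : A) (n : nat) : Prop := has_dim (alg a) n.

Definition algebraic_elt (a : A) : Prop := exists n, elt_degree a n.

Definition algebraic_bounded (S : set A) : Prop :=
  (forall a, S a -> algebraic_elt a) /\
  (exists d : nat, forall a, S a -> forall n, elt_degree a n -> (n <= d)%N).

Definition weight_function (w : {scalar A}) : Prop :=
  (exists x, w x != 0) /\ (forall x y, w (mul x y) = w x * w y).

Definition bernstein (w : {scalar A}) : Prop :=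
  [/\ forall x y, mul x y = mul y x,
      weight_function w &
      forall x, mul (mul x x) (mul x x) = (w x) ^+ 2 *: mul x x].

Definition barideal (w : {scalar A}) : set A := [set x | w x = 0].

Definition peirceU (e : A) : set A := [set u | 2%:R *: mul e u = u].

Definition peirceV (e : A) : set A := [set v | mul e v = 0].

End Algebras.

(* Main.v *)
From HB Require Import structures.
Require Import Defs.
From mathcomp Require Import all_boot all_order all_algebra sesquilinear.
From mathcomp Require Import boolp classical_sets functions cardinality.
From mathcomp Require Import ring.
Set Implicit Arguments.
Unset Strict Implicit.
Unset Printing Implicit Defensive.
Import GRing.Theory.
Local Open Scope ring_scope.
Local Open Scope classical_set_scope.

(* For a = u + v in N = U + V, the linearised Peirce identities make xy = 0 for
   all x, y in the L_v-stable subspace generated by L_v u and V^2; it contains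
   a^3 = 2 L_v^2 u + L_v (v^2) + L_v (u^2), and a x = L_v x, a^2 x = 0 there.
   Hence alg(a) is spanned by a, a^2 and the L_v^k a^3.
   (iii) => (ii): an annihilating polynomial of L_v of degree d leaves at most
   d + 2 of these generators.
   (ii) => (iii): polynomials in L_v killing a^3 for a = u + v and a = -u + v
   give one of bounded degree killing u, because the difference of the two cubes
   is 4 L_v^2 u. A locally algebraic operator of bounded degree is algebraic: if
   m is a local minimal polynomial of maximal degree, every local minimal
   polynomial divides a power of m.
   (ii) => (i): if w(a) = 1 then f = a^2 is idempotent, and for y = a - f
   one has 2 f y = - y^2 in the Peirce space U of f, so Kf + alg(y) is a
   subalgebra; it contains a. *)

(** * Subspaces, spans and dimension *)

Definition subspace (K : fieldType) (A : lmodType K) (W : set A) : Prop :=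
  W 0 /\ forall (k : K) x y, W x -> W y -> W (k *: x + y).

Section Subspaces.
Variables (K : fieldType) (A : lmodType K).
Implicit Types (W : set A).

Lemma subspaceD W x y : subspace W -> W x -> W y -> W (x + y).
Proof. by move=> [_ W2] Wx Wy; rewrite -(scale1r x); apply: W2. Qed.

Lemma subspaceZ W k x : subspace W -> W x -> W (k *: x).
Proof. by move=> [W0 W2] Wx; rewrite -[_ *: _]addr0; apply: W2. Qed.

Lemma subspaceB W x y : subspace W -> W x -> W y -> W (x - y).
Proof.
move=> sW Wx Wy; apply: subspaceD => //.
by rewrite -scaleN1r; apply: subspaceZ.
Qed.

Lemma subspace_sum W (I : Type) (r : seq I) (P : pred I) (F : I -> A) :
  subspace W -> (forall i, P i -> W (F i)) -> W (\sum_(i <- r | P i) F i).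
Proof.
move=> sW WF; elim/big_rec: _ => [|i x Pi Wx]; first exact: sW.1.
by apply: subspaceD => //; apply: WF.
Qed.

Lemma lin_span_subspace n (b : 'I_n -> A) : subspace (lin_span b).
Proof.
split; first by exists (fun=> 0); rewrite big1 // => i _; rewrite scale0r.
move=> k _ _ [c ->] [d ->]; exists (fun i => k * c i + d i).
rewrite scaler_sumr -big_split; apply: eq_bigr => i _.
by rewrite scalerDl scalerA.
Qed.

Lemma mem_lin_span n (b : 'I_n -> A) i : lin_span b (b i).
Proof.
exists (fun j => (i == j)%:R); rewrite (bigD1 i) //= eqxx scale1r.
by rewrite big1 ?addr0 // => j; rewrite eq_sym => /negPf->; rewrite scale0r.
Qed.

Lemma lin_span_sub n (b : 'I_n -> A) W :
  subspace W -> (forall i, W (b i)) -> lin_span b `<=` W.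
Proof.
move=> sW Wb _ [c ->]; apply: subspace_sum => // i _.
exact: subspaceZ.
Qed.

(** If [m < n], the [n] by [m] coefficient matrix has a nonzero row in its left kernel, and that row
    is a dependency among the [b i]. *)
Lemma lin_indep_leq n m (b : 'I_n -> A) (g : 'I_m -> A) :
  lin_indep b -> (forall i, lin_span g (b i)) -> (n <= m)%N.
Proof.
move=> b_ind /choice[C bC]; rewrite leqNgt; apply/negP => lt_mn.
pose M : 'M[K]_(n, m) := \matrix_(i, j) C i j.
have kM : kermx M != 0.
  rewrite kermx_eq0 /row_free; apply/eqP => rM.
  by have := rank_leq_col M; rewrite rM leqNgt lt_mn.
have [i rN0] : exists i, row i (kermx M) != 0.
  apply: contrapT => no; case/eqP: kM; apply/row_matrixP => i.
  by rewrite row0; apply/eqP/negPn/negP => h; apply: no; exists i.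
have rM : row i (kermx M) *m M = 0 by apply/sub_kermxP/row_sub.
case/eqP: rN0; apply/rowP => j; rewrite [RHS]mxE.
apply: (b_ind (fun j => row i (kermx M) 0 j)).
under eq_bigr => k _ do rewrite bC scaler_sumr.
rewrite exchange_big big1 //= => k _.
under eq_bigr => l _ do rewrite scalerA.
rewrite -scaler_suml; have /rowP/(_ k) := rM; rewrite !mxE => rMk.
by under eq_bigr => l _ do [rewrite (_ : C l k = M l k); last by rewrite mxE];
   rewrite rMk scale0r.
Qed.

Lemma lin_indep_extend n (b : 'I_n -> A) x :
  lin_indep b -> ~ lin_span b x ->
  lin_indep (fun i : 'I_n.+1 => if unlift ord0 i is Some j then b j else x).
Proof.
move=> b_ind xNb c; rewrite big_ord_recl unlift_none.
under eq_bigr => i _ do rewrite liftK.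
move=> c0; have c00 : c ord0 = 0.
  apply/eqP/negPn/negP => c0N; apply: xNb.
  exists (fun i => - (c ord0)^-1 * c (lift ord0 i)).
  under eq_bigr => i _ do rewrite -scalerA.
  rewrite -scaler_sumr; move/eqP: c0; rewrite addrC addr_eq0 => /eqP->.
  by rewrite scalerN scaleNr opprK scalerA mulVf // scale1r.
move=> i; case: (unliftP ord0 i) => [j|] -> //.
apply: (b_ind (fun j => c (lift ord0 j))).
by move: c0; rewrite c00 scale0r add0r.
Qed.

(** Independent families in [W] have at most [m] members, so one of maximal size exists; any vector
    outside its span would extend it. *)
Lemma subspace_dim W m (g : 'I_m -> A) :
  subspace W -> W `<=` lin_span g ->
  (exists n, has_dim W n) /\ (forall n, has_dim W n -> (n <= m)%N).
Proof.
move=> sW Wg; split; last first.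
  move=> n [b [b_ind Wb]]; apply: (lin_indep_leq b_ind) => i.
  by apply: Wg; rewrite Wb; apply: mem_lin_span.
pose indep n := exists b : 'I_n -> A, lin_indep b /\ forall i, W (b i).
have ex0 : exists n, `[< indep n >].
  by exists 0%N; apply/asboolP; exists (fun=> 0); split=> [c _|] [].
have bnd n : `[< indep n >] -> (n <= m)%N.
  move=> /asboolP[b [b_ind Wb]]; apply: (lin_indep_leq b_ind) => i.
  exact/Wg/Wb.
case: (ex_maxnP ex0 bnd) => n /asboolP[b [b_ind Wb]] nmax.
exists n, b; split=> //; apply/seteqP; split; last exact: lin_span_sub.
move=> x Wx; apply: contrapT => xNb.
suff /asboolP/nmax : indep n.+1 by rewrite ltnn.
eexists; split; first exact: lin_indep_extend b_ind xNb.
by move=> i /=; case: (unlift ord0 i) => [j|]; [apply: Wb|].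
Qed.

End Subspaces.

(** * Polynomials in a linear operator and local minimal polynomials *)

Section OperatorPolynomials.
Variables (K : fieldType) (A : lmodType K) (T : A -> A).
Hypothesis T_lin : linear T.
HB.instance Definition _ := GRing.isLinear.Build K A A *:%R T T_lin.
Implicit Types (P Q : {poly K}) (x y : A).

Lemma iter_linear n : linear (iter n T).
Proof.
by move=> k x y; elim: n => //= n ->; rewrite linearP.
Qed.

Lemma horner_op_widen n P x : (size P <= n)%N ->
  horner_op P T x = \sum_(i < n) P`_i *: iter i T x.
Proof.
move=> sP; rewrite /horner_op (big_ord_widen n (fun i => P`_i *: iter i T x)) //.
rewrite big_mkcond; apply: eq_bigr => i _; case: ltnP => // h.
by rewrite nth_default // scale0r.
Qed.

Lemma horner_op0 x : horner_op 0 T x = 0.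
Proof. by rewrite /horner_op size_poly0 big_ord0. Qed.

Lemma horner_opP k P Q x :
  horner_op (k *: P + Q) T x = k *: horner_op P T x + horner_op Q T x.
Proof.
pose n := maxn (size P) (size Q).
rewrite !(@horner_op_widen n) ?leq_maxl ?leq_maxr //; last first.
  rewrite (leq_trans (size_polyD _ _)) // geq_max leq_maxr andbT.
  by rewrite (leq_trans (size_scale_leq _ _)) ?leq_maxl.
rewrite scaler_sumr -big_split; apply: eq_bigr => i _.
by rewrite coefD coefZ scalerDl scalerA.
Qed.

Lemma horner_opD P Q x :
  horner_op (P + Q) T x = horner_op P T x + horner_op Q T x.
Proof. by rewrite -[P]scale1r horner_opP !scale1r. Qed.

Lemma horner_opC k x : horner_op k%:P T x = k *: x.
Proof. by rewrite (@horner_op_widen 1) ?size_polyC_leq1 // big_ord1 coefC. Qed.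

Lemma horner_opMX P x : horner_op (P * 'X) T x = horner_op P T (T x).
Proof.
rewrite (@horner_op_widen (size P).+1).
  rewrite big_ord_recl coefMX scale0r add0r; apply: eq_bigr => i _.
  by rewrite coefMX /= -iterSr.
by rewrite (leq_trans (size_polyMleq _ _)) // size_polyX addn2.
Qed.

Lemma horner_op_linear P : linear (horner_op P T).
Proof.
move=> k x y; rewrite /horner_op scaler_sumr -big_split.
apply: eq_bigr => i _ /=.
by rewrite iter_linear scalerDr !scalerA mulrC.
Qed.

HB.instance Definition _ P :=
  GRing.isLinear.Build K A A *:%R (horner_op P T) (horner_op_linear P).

Lemma horner_opx0 P : horner_op P T 0 = 0.
Proof. exact: linear0. Qed.

Lemma horner_opZx P k x : horner_op P T (k *: x) = k *: horner_op P T x.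
Proof. exact: linearZ. Qed.

Lemma horner_op_comm P x : horner_op P T (T x) = T (horner_op P T x).
Proof.
rewrite /horner_op linear_sum; apply: eq_bigr => i _.
by rewrite linearZ -iterSr.
Qed.

Lemma horner_opM P Q x :
  horner_op (P * Q) T x = horner_op P T (horner_op Q T x).
Proof.
elim/poly_ind: P x => [|P c IH] x; first by rewrite mul0r !horner_op0.
rewrite mulrDl mulrAC mul_polyC addrC horner_opP horner_opMX IH horner_opD.
by rewrite horner_opMX horner_opC horner_op_comm addrC.
Qed.

Lemma horner_opXn n x : horner_op 'X^n T x = iter n T x.
Proof.
elim: n x => [|n IH] x; first by rewrite horner_opC scale1r.
by rewrite exprSr horner_opMX IH -iterSr.
Qed.

Lemma subspace_horner_op (W : set A) P x :
  subspace W -> (forall y, W y -> W (T y)) -> W x -> W (horner_op P T x).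
Proof.
move=> sW WT Wx; apply: subspace_sum => // i _; apply: subspaceZ => //.
by elim: (i : nat) => //= n; apply: WT.
Qed.

Definition min_annihilator x (m : {poly K}) : Prop :=
  m != 0 /\ forall q, horner_op q T x = 0 <-> m %| q.

(** A nonzero annihilator of least size divides every other one: the remainder of a division by it
    is a smaller annihilator, hence zero. *)
Lemma min_annihilator_exists x P : P != 0 -> horner_op P T x = 0 ->
  exists2 m, min_annihilator x m & (size m <= size P)%N.
Proof.
move=> P0 Px.
pose good n := exists m, [/\ m != 0, horner_op m T x = 0 & size m = n].
have ex : exists n, `[< good n >] by exists (size P); apply/asboolP; exists P.
case: (ex_minnP ex) => n /asboolP[m [m0 mx sm]] nmin.
exists m; last by rewrite sm; apply: nmin; apply/asboolP; exists P.
split=> // q; split=> [qx|/dvdpP[r ->]]; last by rewrite horner_opM mx linear0.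
apply/negPn/negP => rN0; have := ltn_modp q m; rewrite m0 ltnNge sm nmin //.
apply/asboolP; exists (q %% m); split=> //.
move: qx; rewrite {1}(divp_eq q m) horner_opD horner_opM mx linear0 add0r.
by [].
Qed.

(** If [q] kills [x + y], then [p * q] kills [x] because [p] kills [y]; so [m] divides [p * q],
    hence [q] by coprimality. The argument for [p] is symmetric. *)
Lemma min_annihilatorD x y m p : coprimep m p ->
  min_annihilator x m -> min_annihilator y p ->
  min_annihilator (x + y) (m * p).
Proof.
move=> cop [m0 mx] [p0 py]; split; first by rewrite mulf_neq0.
move=> q; rewrite linearD /=; split=> [qxy|mpq]; last first.
  have /mx-> : m %| q by apply: dvdp_trans mpq; apply: dvdp_mulr.
  have /py-> : p %| q by apply: dvdp_trans mpq; apply: dvdp_mull.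
  by rewrite addr0.
rewrite Gauss_dvdp //; apply/andP; split.
  rewrite -(Gauss_dvdpr q cop); apply/mx.
  have := congr1 (horner_op p T) qxy; rewrite linearD linear0 /= -!horner_opM.
  by rewrite [horner_op (p * q) T y](py _).2 ?dvdp_mulr // addr0.
rewrite coprimep_sym in cop; rewrite -(Gauss_dvdpr q cop); apply/py.
have := congr1 (horner_op m T) qxy; rewrite linearD linear0 /= -!horner_opM.
by rewrite [horner_op (m * q) T x](mx _).2 ?dvdp_mulr // add0r.
Qed.

End OperatorPolynomials.

(** * From local to global annihilating polynomials *)

Lemma dvdp_exp_of_coprime_divisors (K : fieldType) (p m : {poly K}) n :
  (0 < size p <= n.+1)%N ->
  (forall r, r %| p -> coprimep r m -> (size r <= 1)%N) -> p %| m ^+ n.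
Proof.
have unit_dvd (q r : {poly K}) : (0 < size q <= 1)%N -> q %| r.
  by move=> sq; apply: dvdUp; rewrite -size_poly_eq1 eqn_leq andbC.
elim: n p => [|n IH] p sp pm; first exact: unit_dvd.
have [sp1|sp1] := leqP (size p) 1.
  by apply: unit_dvd; rewrite sp1 andbT; case/andP: sp.
have [p_gt0 p_le] := andP sp.
have p0 : p != 0 by rewrite -size_poly_gt0.
(* The gcd is not constant, so dividing [p] by it lowers the size; each division uses up one factor
   [m] of the power. *)
pose g := gcdp p m; have g0 : g != 0 by rewrite gcdp_eq0 (negPf p0).
have sg : (1 < size g)%N.
  rewrite ltn_neqAle eq_sym size_poly_gt0 g0 andbT.
  by apply: contraL sp1 => cop; rewrite -leqNgt; apply: pm.
have gp : g %| p by apply: dvdp_gcdl.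
rewrite -(divpK gp) exprSr; apply: dvdp_mul; last exact: dvdp_gcdr.
have qp : p %/ g %| p by rewrite -{2}(divpK gp) dvdp_mulr.
apply: IH => [|r rq]; last by apply: pm; apply: dvdp_trans qp.
rewrite size_poly_gt0 dvdp_div_eq0 // p0 /= size_divp //.
rewrite leq_subLR (leq_trans p_le) //.
by case: (size g) sg => [|[|k]] //= _; rewrite addSn ltnS leq_addl.
Qed.

(** Take [x] whose local minimal polynomial [m] has maximal size. A nonconstant divisor, coprime to
    [m], of another local minimal polynomial would yield a vector with a larger one. *)
Lemma locally_algebraic_bounded (K : fieldType) (A : lmodType K)
    (T : A -> A) (W : set A) (d : nat) :
  linear T -> subspace W -> (forall x, W x -> W (T x)) ->
  (forall x, W x ->
     exists P : {poly K}, [/\ P != 0, (size P <= d.+1)%N & horner_op P T x = 0]) ->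
  exists Q : {poly K},
    [/\ Q != 0, annihilates_on W T Q & ((size Q).-1 <= d * d)%N].
Proof.
move=> T_lin sW WT loc.
have minP x : W x -> exists2 m, min_annihilator T x m & (size m <= d.+1)%N.
  move=> /loc[P [P0 sP Px]].
  have [m mx sm] := min_annihilator_exists T_lin P0 Px.
  by exists m => //; apply: leq_trans sP.
pose good n := exists x m, [/\ W x, min_annihilator T x m & size m = n].
have ex : exists n, `[< good n >].
  have [m m0 _] := minP 0 sW.1; exists (size m); apply/asboolP.
  by exists 0, m; split=> //; exact: sW.1.
have bnd n : `[< good n >] -> (n <= d.+1)%N.
  move=> /asboolP[x [m [/minP[m' [m'0 m'x] sm'] [m0 mx] <-]]].
  by apply: leq_trans sm'; apply: dvdp_leq => //; apply/mx/m'x.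
case: (ex_maxnP ex bnd) => n /asboolP[x [m [Wx mx sm]]] nmax.
have [m0 _] := mx.
have sm_le : (size m <= d.+1)%N by rewrite sm; apply: bnd; apply/asboolP; exists x, m.
(* Exponent [d] suffices because every local minimal polynomial has degree at most [d]; as [m] does
   too, the power has degree at most [d * d]. *)
exists (m ^+ d); split; first by rewrite expf_neq0.
- move=> y Wy; have [p py sp] := minP y Wy; have [p0 pyE] := py.
  apply/pyE; apply: dvdp_exp_of_coprime_divisors => [|r rp cop].
    by rewrite size_poly_gt0 p0.
  have r0 : r != 0 by apply: contraNneq p0 => r0; move: rp; rewrite r0 dvd0p.
  have q0 : p %/ r != 0 by rewrite dvdp_div_eq0.
  (* Applying the cofactor of [r] to [y] leaves a vector whose local minimal polynomial is exactly
     [r]. *)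
  pose y' := horner_op (p %/ r) T y.
  have ry' : min_annihilator T y' r.
    split=> // q; rewrite /y' -horner_opM //.
    split=> [/pyE|rq]; last by apply/pyE; rewrite -{1}(divpK rp) mulrC dvdp_mul2r.
    by rewrite -{1}(divpK rp) mulrC dvdp_mul2r.
  have Wy' : W y' by apply: subspace_horner_op.
  rewrite coprimep_sym in cop.
  have /nmax : `[< good (size (m * r)) >].
    apply/asboolP; exists (x + y'), (m * r); split=> //.
      exact: subspaceD.
    exact: min_annihilatorD.
  (* The size of [m * r] is [size m + size r - 1], so maximality of [size m] forces [r] to be
     constant. *)
  rewrite size_mul // -sm; move: m0; rewrite -size_poly_gt0.
  by case: (size m) => // k _; rewrite addSn /= -(addn1 k) leq_add2l.
- by rewrite size_exp leq_mul2r; apply/orP; right; case: (size m) sm_le.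
Qed.

(** * Comparison of coefficients over an infinite field *)

Lemma poly_coef_eq0 (K : fieldType) (A : lmodType K) (cs : seq A) :
  infinite_set [set: K] ->
  (forall t : K, \sum_(i < size cs) t ^+ i *: cs`_i = 0) ->
  forall i, cs`_i = 0.
Proof.
move=> /infiniteP/card_leP[g] cs0 i.
pose f (n : nat) : K := val (g (SigSub (mem_setT n))).
have f_inj : injective f.
  by move=> m n /val_inj /(inj (mem_setT _) (mem_setT _)) [].
have [lt_i|] := ltnP i (size cs); last exact: nth_default.
pose k := Ordinal lt_i; pose V := Vandermonde (size cs) (\row_(j < size cs) f j).
have V_unit : V \in unitmx.
  rewrite unitmxE det_Vandermonde unitfE; apply/prodf_neq0 => j _.
  apply/prodf_neq0 => l lt_jl; rewrite !mxE subr_eq0; apply/eqP => /f_inj jl.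
  by rewrite jl ltnn in lt_jl.
(* Insert the identity matrix and write it as [V] times its inverse; after exchanging sums, each
   inner sum is the polynomial evaluated at a node [f l]. *)
transitivity (\sum_j (1%:M : 'M[K]_(size cs)) j k *: cs`_j).
  rewrite (bigD1 k) //= mxE eqxx scale1r big1 ?addr0 // => j.
  by rewrite mxE => /negPf->; rewrite scale0r.
rewrite -(mulmxV V_unit).
under eq_bigr => j _ do rewrite mxE scaler_suml.
rewrite exchange_big big1 //= => l _.
under eq_bigr => j _ do rewrite mulrC -scalerA.
rewrite -scaler_sumr.
under eq_bigr => j _ do rewrite !mxE.
by rewrite cs0 scaler0.
Qed.

(* Reflection for identities between linear combinations: [ring] does not apply
   to lmodules, so equality is reduced to equality of the coefficients. *)
Inductive lcomb (K : Type) : Type :=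
  | LAtom of nat
  | LZero
  | LAdd of lcomb K & lcomb K
  | LOpp of lcomb K
  | LScale of K & lcomb K.
Arguments LAtom {K}.
Arguments LZero {K}.

(** * Formal linear combinations and their coefficients *)

Section LinearCombinations.
Variables (K : fieldType) (A : lmodType K).

Fixpoint lcomb_eval (env : seq A) (E : lcomb K) : A :=
  match E with
  | LAtom j => env`_j
  | LZero => 0
  | LAdd E1 E2 => lcomb_eval env E1 + lcomb_eval env E2
  | LOpp E1 => - lcomb_eval env E1
  | LScale k E1 => k *: lcomb_eval env E1
  end.

(** Indices are compared by [eqn] so that [cbn] decides the comparison and leaves pure scalar
    identities to [ring]. *)
Fixpoint lcomb_coef (i : nat) (E : lcomb K) : K :=
  match E with
  | LAtom j => if eqn i j then 1 else 0
  | LZero => 0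
  | LAdd E1 E2 => lcomb_coef i E1 + lcomb_coef i E2
  | LOpp E1 => - lcomb_coef i E1
  | LScale k E1 => k * lcomb_coef i E1
  end.

Fixpoint lcomb_eq (n : nat) (E1 E2 : lcomb K) : Prop :=
  if n is n'.+1 then
    lcomb_coef n' E1 = lcomb_coef n' E2 /\ lcomb_eq n' E1 E2
  else True.

Lemma lcomb_evalE env E :
  lcomb_eval env E = \sum_(i < size env) lcomb_coef i E *: env`_i.
Proof.
elim: E => [j||E1 IH1 E2 IH2|E1 IH|k E1 IH] /=.
- have [lt_j|le_j] := ltnP j (size env).
    rewrite (bigD1 (Ordinal lt_j)) //= -[eqn _ _]/(j == j) eqxx scale1r.
    rewrite big1 ?addr0 // => i /eqP i_j.
    rewrite -[eqn _ _]/((i : nat) == j); case: eqP => [ij|_]; last by rewrite scale0r.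
    by case: i_j; apply: val_inj.
  rewrite nth_default // big1 // => i _.
  rewrite -[eqn _ _]/((i : nat) == j); case: eqP => [ij|_].
    by have := ltn_ord i; rewrite ij ltnNge le_j.
  by rewrite scale0r.
- by rewrite big1 // => i _; rewrite scale0r.
- rewrite IH1 IH2 -big_split; apply: eq_bigr => i _; by rewrite scalerDl.
- by rewrite IH -sumrN; apply: eq_bigr => i _; rewrite scaleNr.
- by rewrite IH scaler_sumr; apply: eq_bigr => i _; rewrite scalerA.
Qed.

Lemma lcomb_eqP env E1 E2 :
  lcomb_eq (size env) E1 E2 -> lcomb_eval env E1 = lcomb_eval env E2.
Proof.
move=> eqE; rewrite !lcomb_evalE; apply: eq_bigr => i _; congr (_ *: _).
elim: (size env) eqE (i : nat) (ltn_ord i) => //= n IH [eqn eqE] j.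
by rewrite ltnS leq_eqVlt => /orP[/eqP->|] //; apply: IH.
Qed.

End LinearCombinations.

(** * A tactic for linear identities in a module *)

Ltac lc_index x env :=
  lazymatch env with
  | x :: _ => constr:(O)
  | _ :: ?env' => let n := lc_index x env' in constr:(S n)
  end.

Ltac lc_atoms x env :=
  lazymatch x with
  | @GRing.add _ ?a ?b => let env1 := lc_atoms a env in lc_atoms b env1
  | @GRing.opp _ ?a => lc_atoms a env
  | @GRing.scale _ _ _ ?a => lc_atoms a env
  | @GRing.zero _ => env
  | _ => lazymatch env with
         | context [x :: _] => env
         | _ => constr:(x :: env)
         end
  end.

Ltac lc_reify K x env :=
  lazymatch x with
  | @GRing.add _ ?a ?b =>
      let a' := lc_reify K a env in
      let b' := lc_reify K b env in constr:(@LAdd K a' b')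
  | @GRing.opp _ ?a => let a' := lc_reify K a env in constr:(@LOpp K a')
  | @GRing.scale _ _ ?k ?a =>
      let a' := lc_reify K a env in constr:(@LScale K k a')
  | @GRing.zero _ => constr:(@LZero K)
  | _ => let n := lc_index x env in constr:(@LAtom K n)
  end.

Ltac lcomb K A :=
  lazymatch goal with
  | |- ?x = ?y =>
      let env0 := lc_atoms x constr:(@nil A) in
      let env := lc_atoms y env0 in
      let x' := lc_reify (GRing.Field.sort K) x env in
      let y' := lc_reify (GRing.Field.sort K) y env in
      apply: (@lcomb_eqP K A env x' y'); cbn [lcomb_eq lcomb_coef size eqn];
      repeat (split; first ring); exact: I
  end.

Lemma char_neq0 (K : fieldType) p : prime p -> p \notin [pchar K] -> p%:R != 0 :> K.
Proof. by move=> p_pr; apply: contraNneq => p0; rewrite inE p_pr p0 /=. Qed.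

(** * Generated subalgebras and bounded degrees *)

Section GeneratedSubalgebra.
Variables (K : fieldType) (A : lmodType K) (mul : {bilinear A -> A -> A}).
Implicit Types (a : A) (B S : set A).

Lemma alg_subalgebra a : subalgebra mul (alg mul a).
Proof.
split; first by move=> B [[B0 _ _] _].
- move=> k x y xa ya B B_a; have [[_ B2 _] _] := B_a.
  by apply: B2; [exact: xa | exact: ya].
- move=> x y xa ya B B_a; have [[_ _ BM] _] := B_a.
  by apply: BM; [exact: xa | exact: ya].
Qed.

Lemma alg_subspace a : subspace (alg mul a).
Proof. by have [? ? _] := alg_subalgebra a. Qed.

Lemma mem_alg a : alg mul a a.
Proof. by move=> B [_]; apply. Qed.

Lemma alg_min a B : subalgebra mul B -> B a -> alg mul a `<=` B.
Proof. by move=> sB Ba x; apply; split=> // _ ->. Qed.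

Lemma algebraic_bounded_span S d :
  (forall a, S a -> exists g : 'I_d -> A, alg mul a `<=` lin_span g) ->
  algebraic_bounded mul S.
Proof.
move=> Sg; split=> [a /Sg[g ag]|].
  by have [] := subspace_dim (alg_subspace a) ag.
exists d => a /Sg[g ag]; by have [] := subspace_dim (alg_subspace a) ag.
Qed.

Lemma algebraic_bounded_dim S : algebraic_bounded mul S ->
  exists d, forall a, S a -> exists2 n, (n <= d)%N & has_dim (alg mul a) n.
Proof.
move=> [S_alg [d Sd]]; exists d => a Sa; have [n an] := S_alg a Sa.
by exists n => //; apply: Sd an.
Qed.

End GeneratedSubalgebra.

(** Replaces algebraicity plus a bound on exact degrees by one uniform bound on annihilators; an
    exact degree exists as the least degree of an annihilator. *)
Lemma op_degree_bounded_annihilator (K : fieldType) (A : lmodType K)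
    (W : set A) (F : set (A -> A)) :
  (forall T, F T -> algebraic_op_on W T) /\
  (exists d, forall T, F T -> forall n, op_degree_on W T n -> (n <= d)%N) <->
  exists d, forall T, F T -> exists P : {poly K},
    [/\ P != 0, annihilates_on W T P & ((size P).-1 <= d)%N].
Proof.
split=> [[F_alg [d Fd]]|[d Fd]].
  exists d => T FT; pose good n := exists P : {poly K},
    [/\ P != 0, annihilates_on W T P & (size P).-1 = n].
  have ex : exists n, `[< good n >].
    have [P [P0 PT]] := F_alg T FT.
    by exists (size P).-1; apply/asboolP; exists P.
  case: (ex_minnP ex) => n /asboolP[P [P0 PT sP]] nmin; exists P; split=> //.
  rewrite sP; apply: (Fd T FT); split; first by exists P.
  by move=> Q Q0 QT; apply/nmin/asboolP; exists Q.
split=> [T /Fd[P [P0 PT _]]|]; first by exists P.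
exists d => T /Fd[P [P0 PT sP]] n [_ nmin].
exact: leq_trans (nmin P P0 PT) sP.
Qed.

(** * Bernstein algebras: weight and multiplication rules *)

Section BernsteinAlgebra.
Variables (K : fieldType) (A : lmodType K).
Variables (mul : {bilinear A -> A -> A}) (w : {scalar A}).
Hypotheses (K_infinite : infinite_set [set: K]) (two_neq0 : 2%:R != 0 :> K).
Hypothesis A_bernstein : bernstein mul w.

Local Notation "x ** y" := (mul x y) (at level 40, left associativity).

Let mulC x y : x ** y = y ** x.
Proof. by case: A_bernstein. Qed.

Let mulDl x y z : (x + y) ** z = x ** z + y ** z.
Proof. exact: linearDl. Qed.

Let mulDr x y z : z ** (x + y) = z ** x + z ** y.
Proof. exact: linearDr. Qed.

Let mulZl k x y : (k *: x) ** y = k *: (x ** y).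
Proof. exact: linearZl_LR. Qed.

Let mulZr k x y : y ** (k *: x) = k *: (y ** x).
Proof. exact: linearZr_LR. Qed.

Let mulNl x y : (- x) ** y = - (x ** y).
Proof. exact: linearNl. Qed.

Let mulNr x y : y ** (- x) = - (y ** x).
Proof. exact: linearNr. Qed.

Let mul0x x : 0 ** x = 0.
Proof. exact: linear0l. Qed.

Let mulx0 x : x ** 0 = 0.
Proof. exact: linear0r. Qed.

Let mulE := (mulDl, mulDr, mulZl, mulZr, mulNl, mulNr, mul0x, mulx0).

Let wM x y : w (x ** y) = w x * w y.
Proof. by case: A_bernstein => _ [_ ->]. Qed.

Let wP k x y : w (k *: x + y) = k * w x + w y.
Proof. exact: linearP. Qed.

(** The Bernstein identity gives [e = w(e)^2 e], so [w(e)] is nonzero, while [w(e)^2 = w(e)]. *)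
Lemma weight_idempotent e : e != 0 -> e ** e = e -> w e = 1.
Proof.
move=> e0 ee; case: A_bernstein => _ _ /(_ e); rewrite !ee => e_w.
have we0 : w e != 0.
  by apply: contraNneq e0 => we0; rewrite e_w we0 expr0n scale0r.
by apply: (mulfI we0); rewrite -wM ee mulr1.
Qed.

(** * Peirce decomposition and its identities *)

Section PeirceDecomposition.
Variable e : A.
Hypotheses (e_idem : e ** e = e) (we1 : w e = 1).
Local Notation U := (peirceU mul e).
Local Notation V := (peirceV mul e).
Local Notation E x := (2%:R *: (e ** x)).

(** The Bernstein identity at [t y + e], an element of weight 1, holds for all scalars [t], so each
    coefficient of [t] vanishes. *)
Lemma bernstein_components y : w y = 0 ->
  [/\ E (E y) = E y, E (y ** y) + E y ** E y = y ** y,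
      E y ** (y ** y) = 0 & (y ** y) ** (y ** y) = 0].
Proof.
move=> wy.
(* Coefficients of [t^0] to [t^4] in [(x^2)^2 - x^2] for [x = t y + e]; the constant one vanishes as
   [e] is idempotent. *)
pose cs := [:: 0; E (E y) - E y; E (y ** y) + E y ** E y - y ** y;
  2%:R *: (E y ** (y ** y)); (y ** y) ** (y ** y)].
have cs0 : forall i, cs`_i = 0.
  apply: poly_coef_eq0 => // t.
  case: A_bernstein => _ _ /(_ (t *: y + e)) /eqP; rewrite -subr_eq0.
  rewrite wP wy mulr0 add0r we1 expr1n scale1r => /eqP x4.
  rewrite -[RHS]x4 {x4}.
  rewrite /cs /= !big_ord_recl big_ord0 /= /bump /=; do ?rewrite mulE ?e_idem.
  rewrite ?(mulC y e) ?(mulC (e ** y) e) ?(mulC (y ** y) e) (mulC (y ** y) (e ** y)).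
  lcomb K A.
split.
- by apply/eqP; rewrite -subr_eq0; apply/eqP; apply: (cs0 1%N).
- by apply/eqP; rewrite -subr_eq0; apply/eqP; apply: (cs0 2%N).
- have /eqP := cs0 3%N; rewrite /= scaler_eq0 (negPf two_neq0) /=.
  by move/eqP.
- exact: (cs0 4%N).
Qed.

Lemma eq_of_subr (M : zmodType) (a b c d : M) : c = d -> a - b = c - d -> a = b.
Proof. by move=> ->; rewrite subrr => /eqP; rewrite subr_eq0 => /eqP. Qed.

Lemma half_scale (x : A) : 2%:R^-1 *: (2%:R *: x) = x.
Proof. by rewrite scalerA mulVf // scale1r. Qed.

Lemma two_scale_eq0 (x : A) : 2%:R *: x = 0 -> x = 0.
Proof. by move/eqP; rewrite scaler_eq0 (negPf two_neq0) => /eqP. Qed.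

Lemma peirceU_subspace : subspace U.
Proof.
split; first by rewrite /peirceU /= mulx0 scaler0.
move=> k x y Ux Uy; rewrite /peirceU /= mulDr mulZr scalerDr scalerA mulrC.
by rewrite -scalerA Ux Uy.
Qed.

Lemma peirceV_subspace : subspace V.
Proof.
split; first by rewrite /peirceV /= mulx0.
by move=> k x y Vx Vy; rewrite /peirceV /= mulDr mulZr Vx Vy scaler0 addr0.
Qed.

Lemma weight_peirceU u : U u -> w u = 0.
Proof.
move=> Uu; have := congr1 w Uu; rewrite -[_ *: _]addr0 wP wM we1 mul1r.
rewrite linear0 addr0 mulr_natl mulr2n => /eqP.
by rewrite -subr_eq0 addrK => /eqP.
Qed.

Lemma weight_peirceV v : V v -> w v = 0.
Proof. by move=> Vv; have := congr1 w Vv; rewrite wM we1 mul1r linear0. Qed.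

(** On the barideal [2 L_e] is a projection; its image lies in [U] and its kernel is [V]. *)
Lemma peirce_decomposition y : w y = 0 ->
  exists u v, [/\ U u, V v & y = u + v].
Proof.
move=> /bernstein_components[EEy _ _ _].
exists (E y), (y - E y); split=> //; last by rewrite addrC subrK.
rewrite /peirceV /= mulDr mulNr mulZr.
move: EEy => /(congr1 (fun x => 2%:R^-1 *: x)); rewrite !half_scale.
by rewrite mulZr => ->; rewrite subrr.
Qed.

Lemma peirceU_sq u : U u -> V (u ** u).
Proof.
move=> Uu; have [_ + _ _] := bernstein_components (weight_peirceU Uu).
by rewrite Uu -[RHS]add0r => /addIr /two_scale_eq0.
Qed.

Lemma peirceV_sq v : V v -> U (v ** v).
Proof.
move=> Vv; have [_ + _ _] := bernstein_components (weight_peirceV Vv).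
by rewrite [e ** v]Vv scaler0 mul0x addr0.
Qed.

Lemma weight_peirceUV u v : U u -> V v -> w (u + v) = 0.
Proof.
by move=> Uu Vv; rewrite linearD /= weight_peirceU // weight_peirceV // addr0.
Qed.

Lemma sqrD x y : (x + y) ** (x + y) = x ** x + 2%:R *: (x ** y) + y ** y.
Proof. by rewrite !mulE (mulC y x); lcomb K A. Qed.

Lemma peirceVV v v' : V v -> V v' -> U (v ** v').
Proof.
move=> Vv Vv'; rewrite -[v ** v']half_scale.
apply: (subspaceZ _ peirceU_subspace).
have -> : 2%:R *: (v ** v') = (v + v') ** (v + v') - v ** v - v' ** v'.
  by rewrite sqrD; lcomb K A.
do !apply: (subspaceB peirceU_subspace); apply: peirceV_sq => //.
exact: (subspaceD peirceV_subspace).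
Qed.

(** For [y = u + v] the second component identity reduces, once the squares of [u] and [v] cancel,
    to [E (2 vu) = 2 vu]. *)
Lemma peirceVU u v : U u -> V v -> U (v ** u).
Proof.
move=> Uu Vv; have [_ + _ _] := bernstein_components (weight_peirceUV Uu Vv).
have -> : E (u + v) = u by rewrite mulDr [e ** v]Vv addr0.
have -> : E ((u + v) ** (u + v)) = 2%:R *: (2%:R *: (e ** (v ** u))) + v ** v.
  rewrite sqrD (mulC u v) !mulDr [e ** (u ** u)]peirceU_sq // add0r mulZr.
  by rewrite scalerDr -[in RHS](peirceV_sq Vv).
rewrite sqrD (mulC u v) => eq; rewrite /peirceU /=.
rewrite -[LHS]half_scale -[RHS]half_scale; congr (_ *: _).
by apply: (eq_of_subr eq); lcomb K A.
Qed.

(** For [y = t u + v] one has [E y = t u]; the three products are, up to a factor 2, the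
    coefficients of [t] in [E y ** (y ** y) = 0]. *)
Lemma peirce_cubic u v : U u -> V v ->
  [/\ u ** (u ** u) = 0, u ** (v ** u) = 0 & u ** (v ** v) = 0].
Proof.
move=> Uu Vv.
pose cs := [:: 0; u ** (v ** v); 2%:R *: (u ** (v ** u)); u ** (u ** u)].
have cs0 : forall i, cs`_i = 0.
  apply: poly_coef_eq0 => // t.
  have Utu : U (t *: u) := subspaceZ t peirceU_subspace Uu.
  have [_ _ + _] := bernstein_components (weight_peirceUV Utu Vv).
  have -> : E (t *: u + v) = t *: u.
    by rewrite mulDr [e ** v]Vv addr0; apply: Utu.
  move=> y3; rewrite -[RHS]y3 /cs /= !big_ord_recl big_ord0 /= /bump /=.
  by rewrite sqrD !mulE (mulC u v); lcomb K A.
split; [exact: (cs0 3%N) | exact: two_scale_eq0 (cs0 2%N) | exact: (cs0 1%N)].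
Qed.

Lemma peirceU_VV u v v' : U u -> V v -> V v' -> u ** (v ** v') = 0.
Proof.
move=> Uu Vv Vv'.
have [_ _ +] := peirce_cubic Uu (subspaceD peirceV_subspace Vv Vv').
have [_ _ v2] := peirce_cubic Uu Vv; have [_ _ v'2] := peirce_cubic Uu Vv'.
by rewrite sqrD !mulDr v2 v'2 add0r addr0 mulZr => /two_scale_eq0.
Qed.

(** Linearisation in [u] of [u (v u) = 0]: each [L_v] is skew for the product on [U]. *)
Lemma peirce_skew u u' v : U u -> U u' -> V v ->
  u ** (v ** u') = - ((v ** u) ** u').
Proof.
move=> Uu Uu' Vv; apply/eqP; rewrite -addr_eq0; apply/eqP.
have [_ + _] := peirce_cubic (subspaceD peirceU_subspace Uu Uu') Vv.
have [_ uu _] := peirce_cubic Uu Vv; have [_ u'u' _] := peirce_cubic Uu' Vv.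
by rewrite !mulDr !mulDl uu u'u' add0r addr0 (mulC u' (v ** u)) addrC.
Qed.

(** Subtracting the cube of [u - x] from that of [u + x] keeps the terms odd in [x], and
    [x^3 = 0]. *)
Lemma peirceU_sqM u x : U u -> U x -> (u ** u) ** x = - 2%:R *: (u ** (u ** x)).
Proof.
move=> Uu Ux; have V0 := peirceV_subspace.1.
have [+ _ _] := peirce_cubic (subspaceD peirceU_subspace Uu Ux) V0.
have [+ _ _] := peirce_cubic (subspaceB peirceU_subspace Uu Ux) V0.
have [u3 _ _] := peirce_cubic Uu V0; have [x3 _ _] := peirce_cubic Ux V0.
rewrite !mulE u3 x3 (mulC x u) (mulC x (u ** u)) (mulC x (u ** x)) => m p.
apply/eqP; rewrite scaleNr -addr_eq0; apply/eqP/two_scale_eq0.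
apply: (eq_of_subr (congr2 (fun y y' => y - y') p m)).
by lcomb K A.
Qed.

(** The [t^2] coefficient of [((t u + v)^2)^2 = 0] is [4 (vu)^2 + 2 u^2 v^2], and
    [u^2 v^2 = -2 u (u v^2) = 0] because [v^2] lies in [U]. *)
Lemma peirceVU_sq u v : U u -> V v -> (v ** u) ** (v ** u) = 0.
Proof.
move=> Uu Vv.
pose cs := [:: (v ** v) ** (v ** v); 4%:R *: ((v ** u) ** (v ** v));
  4%:R *: ((v ** u) ** (v ** u)) + 2%:R *: ((u ** u) ** (v ** v));
  4%:R *: ((u ** u) ** (v ** u)); (u ** u) ** (u ** u)].
have cs0 : forall i, cs`_i = 0.
  apply: poly_coef_eq0 => // t.
  have Utu : U (t *: u) := subspaceZ t peirceU_subspace Uu.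
  have [_ _ _ y4] := bernstein_components (weight_peirceUV Utu Vv).
  rewrite -[RHS]y4 /cs /= !big_ord_recl big_ord0 /= /bump /=.
  rewrite sqrD !mulE (mulC u v) (mulC (v ** u) (u ** u)).
  by rewrite (mulC (v ** v) (u ** u)) (mulC (v ** v) (v ** u)); lcomb K A.
have := cs0 2%N; rewrite /= peirceU_sqM //; last exact: peirceV_sq.
rewrite (peirceU_VV Uu Vv Vv) mulx0 !scaler0 addr0.
have -> : 4%:R = 2%:R * 2%:R :> K by ring.
by rewrite -scalerA => /two_scale_eq0/two_scale_eq0.
Qed.

(** * The subalgebra generated by [u + v] *)

Section CyclicPart.
Variables (u v : A).
Hypotheses (Uu : U u) (Vv : V v).
Local Notation L := (mul v).
Local Notation a := (u + v).
Local Notation z := (a ** (a ** a)).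

Let L_lin : linear L.
Proof. exact: linearP. Qed.

Let L_U x : U x -> U (L x).
Proof. by move=> Ux; apply: peirceVU. Qed.

Lemma peirceU_iter n x : U x -> U (iter n L x).
Proof. by move=> Ux; elim: n => //= n; apply: L_U. Qed.

Lemma peirceU_horner P x : U x -> U (horner_op P L x).
Proof. exact: (subspace_horner_op P peirceU_subspace L_U). Qed.

(** Skewness replaces [x] by [L x] and lowers [n] by two; the base cases are [x (L x) = 0] and
    [(L x)^2 = 0]. *)
Lemma mul_iter_self n x : U x -> x ** iter n.+1 L x = 0.
Proof.
move: x; have [m] := ubnP n; elim: m n => // m IH [|[|n]] lt_n x Ux.
- by have [] := peirce_cubic Ux Vv.
- by rewrite iterS peirce_skew ?peirceVU_sq ?oppr0 //; apply: peirceU_iter.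
- rewrite iterS peirce_skew //; last exact: peirceU_iter.
  rewrite iterSr IH ?oppr0 //; [by rewrite ltnS in lt_n; apply: ltnW | exact: L_U].
Qed.

(** Skewness moves all iterates to one side, giving [x ** iter (i + j) L x] up to sign. *)
Lemma mul_iter_iter i j x : U x -> (0 < i + j)%N ->
  iter i L x ** iter j L x = 0.
Proof.
move=> Ux; elim: i j => [|i IH] j ij.
  by case: j ij => // j _; apply: mul_iter_self.
have := peirce_skew (peirceU_iter i Ux) (peirceU_iter j Ux) Vv.
by rewrite -!iterS IH ?addnS // => /esym/eqP; rewrite oppr_eq0 => /eqP.
Qed.

Lemma mul_horner_op P x y : (forall i, iter i L x ** y = 0) ->
  horner_op P L x ** y = 0.
Proof.
move=> xy; rewrite /horner_op linear_sumlz big1 //= => i _.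
by rewrite mulZl xy scaler0.
Qed.

(** The annihilator of [U] inside [U]; it absorbs [V^2] and is stable under [L_v] by skewness. *)
Definition peirce_radical : set A := [set r | U r /\ forall x, U x -> x ** r = 0].

Lemma peirce_radical_subspace : subspace peirce_radical.
Proof.
have sU := peirceU_subspace.
split; first by split=> [|x _]; [exact: sU.1 | rewrite mulx0].
move=> k x y [Ux x0] [Uy y0]; split=> [|t Ut]; first exact: sU.2.
by rewrite mulDr mulZr x0 // y0 // scaler0 addr0.
Qed.

Lemma peirce_radical_stable r : peirce_radical r -> peirce_radical (L r).
Proof.
move=> [Ur r0]; split; first exact: L_U.
by move=> x Ux; rewrite peirce_skew // r0 ?oppr0 //; apply: L_U.
Qed.

Lemma peirce_radicalVV x y : V x -> V y -> peirce_radical (x ** y).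
Proof.
by move=> Vx Vy; split=> [|t Ut]; [exact: peirceVV | exact: peirceU_VV].
Qed.

(* Contains the U-component of (u + v)^2 and all higher powers of u + v. *)
Definition null_part : set A :=
  [set x | exists P r, peirce_radical r /\ x = horner_op P L (L u) + r].

Lemma null_part_subspace : subspace null_part.
Proof.
split.
  exists 0, 0; rewrite horner_op0 addr0; split=> //.
  exact: peirce_radical_subspace.1.
move=> k _ _ [P [r [Rr ->]]] [Q [s [Rs ->]]].
exists (k *: P + Q), (k *: r + s); split; first exact: peirce_radical_subspace.2.
by rewrite horner_opP // scalerDr addrACA.
Qed.

Lemma null_part_stable x : null_part x -> null_part (L x).
Proof.
move=> [P [r [Rr ->]]]; exists (P * 'X), (L r).
split; first exact: peirce_radical_stable.
by rewrite horner_opMX mulDr -horner_op_comm.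
Qed.

Lemma null_partU x : null_part x -> U x.
Proof.
move=> [P [r [[Ur _] ->]]]; apply: (subspaceD peirceU_subspace) => //.
exact/peirceU_horner/L_U.
Qed.

Lemma mul_null_part x y : U x -> (forall i, iter i.+1 L u ** x = 0) ->
  null_part y -> x ** y = 0.
Proof.
move=> Ux ux [P [r [[_ r0] ->]]]; rewrite mulDr r0 // addr0 mulC.
by apply: mul_horner_op => i; rewrite -iterSr.
Qed.

Lemma mul_null_part_u x : null_part x -> u ** x = 0.
Proof.
by apply: mul_null_part => // i; apply: (@mul_iter_iter _ 0).
Qed.

Lemma null_part_sq x y : null_part x -> null_part y -> x ** y = 0.
Proof.
move=> Nx; have Ux := null_partU Nx; apply: mul_null_part => // i.
have {Nx Ux}[P [r [[Ur r0] ->]]] := Nx.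
have Ui := peirceU_iter i.+1 Uu.
rewrite mulDr r0 // addr0 mulC; apply: mul_horner_op => j.
by rewrite -iterSr; apply: mul_iter_iter.
Qed.

Lemma mul_null_part_usq x : null_part x -> (u ** u) ** x = 0.
Proof.
move=> Nx; rewrite peirceU_sqM //; last exact: null_partU.
by rewrite (mul_null_part_u Nx) mulx0 scaler0.
Qed.

Lemma sq_null_part : exists2 p, null_part p & a ** a = p + u ** u.
Proof.
exists (2%:R *: L u + v ** v).
  exists 2%:R%:P, (v ** v); rewrite horner_opC //.
  by split=> //; apply: peirce_radicalVV.
by rewrite sqrD (mulC u v) addrC addrA addrAC -addrA addrC; lcomb K A.
Qed.

Lemma mul_null_part_a x : null_part x -> a ** x = L x.
Proof. by move=> Nx; rewrite mulDl mul_null_part_u // add0r. Qed.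

Lemma mul_null_part_sq x : null_part x -> (a ** a) ** x = 0.
Proof.
have [p Np ->] := sq_null_part => Nx.
by rewrite mulDl null_part_sq // mul_null_part_usq // addr0.
Qed.

Lemma cubeE : z = 2%:R *: iter 2 L u + (L (v ** v) + L (u ** u)).
Proof.
have [u3 uvu uvv] := peirce_cubic Uu Vv.
by rewrite sqrD (mulC u v) !mulE u3 uvu uvv /=; lcomb K A.
Qed.

Lemma cube_null_part : null_part z.
Proof.
rewrite cubeE; exists (2%:R *: 'X), (L (v ** v) + L (u ** u)); split.
  apply: subspaceD; first exact: peirce_radical_subspace.
    exact/peirce_radical_stable/peirce_radicalVV.
  by apply: peirce_radicalVV => //; apply: peirceU_sq.
congr (_ + _); rewrite -[_ *: 'X]addr0 horner_opP // horner_op0 addr0.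
by rewrite -['X]mul1r horner_opMX horner_opC scale1r.
Qed.

Lemma horner_cube_null_part P : null_part (horner_op P L z).
Proof.
apply: subspace_horner_op null_part_stable cube_null_part.
exact: null_part_subspace.
Qed.

Definition power_span : set A := [set x | exists c1 c2 P,
  x = c1 *: a + c2 *: (a ** a) + horner_op P L z].

Lemma power_span_subalgebra : subalgebra mul power_span.
Proof.
split.
- by exists 0, 0, 0; rewrite horner_op0 !scale0r !addr0.
- move=> k _ _ [c1 [c2 [P ->]]] [d1 [d2 [Q ->]]].
  exists (k * c1 + d1), (k * c2 + d2), (k *: P + Q).
  by rewrite horner_opP //; lcomb K A.
- move=> _ _ [c1 [c2 [P ->]]] [d1 [d2 [Q ->]]].
  (* The products [a a^2] contribute the constant multiple of [z]; the products of [a] with the null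
     parts act as [L_v], hence the factor ['X]. All other products except [a a] vanish. *)
  exists 0, (c1 * d1), ((c1 * d2 + c2 * d1)%:P + (c1 *: Q + d1 *: P) * 'X).
  have [_ _ _ a4] := bernstein_components (weight_peirceUV Uu Vv).
  have NP := horner_cube_null_part P; have NQ := horner_cube_null_part Q.
  rewrite horner_opD // horner_opC // horner_opMX horner_opP //.
  rewrite -[d1 *: P]addr0 horner_opP // horner_op0 // addr0 !horner_op_comm //.
  rewrite -!mul_null_part_a //.
  move: (horner_op P L z) (horner_op Q L z) NP NQ => s t Ns Nt.
  have ts0 := mul_null_part_sq Nt; have st0 := mul_null_part_sq Ns.
  have ss0 := null_part_sq Ns Nt; move: a4 ts0 st0 ss0.
  move: (u + v) => b b4 bt bs st.
  rewrite !mulE b4 bt st (mulC s (b ** b)) bs (mulC s b) (mulC (b ** b) b).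
  by lcomb K A.
Qed.

(** For the reverse inclusion, [L_v] acts on the null part as multiplication by [a], so each
    [L_v^i z] is a power of [a]. *)
Lemma alg_power_span : alg mul a = power_span.
Proof.
have a_alg := @mem_alg _ _ mul a.
apply/seteqP; split=> [|_ [c1 [c2 [P ->]]]].
  apply: alg_min; first exact: power_span_subalgebra.
  by exists 1, 0, 0; rewrite horner_op0 scale1r scale0r !addr0.
have alg_sp := alg_subspace mul a.
have [_ _ algM] := alg_subalgebra mul a.
have aa_alg := algM _ _ a_alg a_alg.
apply: (subspaceD alg_sp).
  by apply: (subspaceD alg_sp); apply: (subspaceZ _ alg_sp).
rewrite /horner_op; apply: subspace_sum => // i _; apply: (subspaceZ _ alg_sp).
elim: (i : nat) => [|n IH]; first exact: algM.
rewrite iterS -mul_null_part_a; first exact: algM.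
by rewrite -horner_opXn //; apply: horner_cube_null_part.
Qed.

End CyclicPart.

(** * Degree bounds between [alg (u + v)] and [L_v] *)

Lemma alg_sub_lin_span u v P d : U u -> V v -> P != 0 ->
  annihilates_on U (mul v) P -> ((size P).-1 <= d)%N ->
  exists g : 'I_d.+2 -> A, alg mul (u + v) `<=` lin_span g.
Proof.
move=> Uu Vv P0 PU sP; have L_lin : linear (mul v) by exact: linearP.
pose a := u + v; pose z := a ** (a ** a).
(* The first [d] slots hold the iterates of [z], slot [d] holds [a], and the last one [a^2]. They
   suffice since reduction modulo [P] leaves remainders of size at most [d]. *)
exists (fun i : 'I_d.+2 => if (i < d)%N then iter i (mul v) z
                           else if i == d :> nat then a else a ** a).
rewrite alg_power_span // => _ [c1 [c2 [Q ->]]].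
set g := (g in lin_span g); have sg := lin_span_subspace g.
have g_lt i : (i < d)%N -> lin_span g (iter i (mul v) z).
  move=> lt_id; have lt_i : (i < d.+2)%N by rewrite !ltnS ltnW // ltnW.
  have := mem_lin_span g (Ordinal lt_i); rewrite {2}/g /=.
  by rewrite lt_id.
have ga : lin_span g a.
  have lt_d : (d < d.+2)%N by [].
  have := mem_lin_span g (Ordinal lt_d); rewrite {2}/g /=.
  by rewrite ltnn eqxx.
have gaa : lin_span g (a ** a).
  have := mem_lin_span g ord_max; rewrite {2}/g /=.
  by rewrite ltnNge leqnSn /= eqn_leq ltnn.
have hQ : horner_op (Q %/ P * P) (mul v) z = 0.
  rewrite mulrC horner_opM // PU //; apply: (null_partU Uu Vv).
  exact: horner_cube_null_part.
rewrite (divp_eq Q P) horner_opD // hQ add0r.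
do !apply: (subspaceD sg); do ?exact: subspaceZ.
rewrite (@horner_op_widen _ _ _ d); first last.
  by rewrite -ltnS (leq_trans (ltn_modpN0 _ P0)) // (leq_trans (leqSpred _)).
by apply: subspace_sum => // i _; apply: subspaceZ => //; apply: g_lt.
Qed.

(** The [d + 1] iterates of [z] lie in a space of dimension at most [d]; the coefficients of a
    dependency form [P]. *)
Lemma cube_annihilator u v d n : U u -> V v ->
  has_dim (alg mul (u + v)) n -> (n <= d)%N ->
  exists P : {poly K}, [/\ P != 0, (size P <= d.+1)%N &
    horner_op P (mul v) ((u + v) ** ((u + v) ** (u + v))) = 0].
Proof.
move=> Uu Vv [b [b_ind alg_b]] le_nd; set z := _ ** (_ ** _).
have L_lin : linear (mul v) by exact: linearP.
have z_alg i : alg mul (u + v) (iter i (mul v) z).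
  rewrite alg_power_span //; exists 0, 0, 'X^i.
  by rewrite !scale0r !add0r horner_opXn.
have : ~ lin_indep (fun i : 'I_d.+1 => iter i (mul v) z).
  move=> z_ind; suff : (d < n)%N by rewrite ltnNge le_nd.
  by apply: (lin_indep_leq (g := b) z_ind) => i; rewrite -alg_b.
move=> /existsNP[c /not_implyP[c_sum /existsNP[i ci]]].
exists (\poly_(j < d.+1) c (inord j)).
have coefP (j : 'I_d.+1) : (\poly_(j < d.+1) c (inord j))`_j = c j.
  by rewrite coef_poly ltn_ord inord_val.
split; last 1 first.
- rewrite (@horner_op_widen _ _ _ d.+1) ?size_poly //.
  by rewrite -[RHS]c_sum; apply: eq_bigr => j _; rewrite coefP.
- by apply: contra_notN ci => /eqP P0; rewrite -coefP P0 coef0.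
- exact: size_poly.
Qed.

Lemma peirceV_locally_algebraic d u v : U u -> V v ->
  (forall y, w y = 0 -> exists2 n, (n <= d)%N & has_dim (alg mul y) n) ->
  exists P : {poly K}, [/\ P != 0, (size P <= (d + d + 2).+1)%N &
    horner_op P (mul v) u = 0].
Proof.
move=> Uu Vv dimN; have L_lin : linear (mul v) by exact: linearP.
have UNu : U (- u) by rewrite -scaleN1r; apply: subspaceZ Uu; apply: peirceU_subspace.
have [n le_n dim_p] := dimN _ (weight_peirceUV Uu Vv).
have [m le_m dim_m] := dimN _ (weight_peirceUV UNu Vv).
have [P [P0 sP zP]] := cube_annihilator Uu Vv dim_p le_n.
have [Q [Q0 sQ zQ]] := cube_annihilator UNu Vv dim_m le_m.
(* [P * Q] kills both cubes, hence their difference [4 L_v^2 u]; the factor ['X^2] supplies the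
   [L_v^2]. The degree is at most [d + d + 2]. *)
exists (P * Q * 'X^2); split.
- by rewrite !mulf_neq0 // polyX_eq0.
- rewrite size_mulXn ?mulf_neq0 // (addnC 2%N) -addSn leq_add2r size_mul //.
  by rewrite -subn1 leq_subLR add1n -addnS -addSn leq_add.
- move: zP zQ; rewrite !cubeE //= horner_opM // horner_opXn //=.
  rewrite !mulE opprK; set x := v ** (v ** u); set r := v ** (v ** v) + _ => zP zQ.
  have Pz y : horner_op P (mul v) y = 0 -> horner_op (P * Q) (mul v) y = 0.
    by rewrite mulrC horner_opM // => ->; rewrite horner_opx0.
  have Qz y : horner_op Q (mul v) y = 0 -> horner_op (P * Q) (mul v) y = 0.
    by rewrite horner_opM // => ->; rewrite horner_opx0.
  apply/two_scale_eq0/two_scale_eq0; rewrite -!horner_opZx //.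
  transitivity (horner_op (P * Q) (mul v)
    (-1 *: (2%:R *: - x + r) + (2%:R *: x + r))).
    by congr horner_op; lcomb K A.
  by rewrite horner_op_linear // (Qz _ zQ) (Pz _ zP) scaler0 addr0.
Qed.

(** * Elements of nonzero weight *)

Lemma idempotent_extension_subalgebra B : subspace B ->
  (forall x y, B x -> B y -> B (x ** y)) -> (forall x, B x -> B (e ** x)) ->
  subalgebra mul [set x | exists k b, B b /\ x = k *: e + b].
Proof.
move=> sB BM Be; split.
- by exists 0, 0; rewrite scale0r addr0; split=> //; exact: sB.1.
- move=> k _ _ [l [b [Bb ->]]] [m [c [Bc ->]]].
  exists (k * l + m), (k *: b + c); split; first exact: sB.2.
  by lcomb K A.
- move=> _ _ [l [b [Bb ->]]] [m [c [Bc ->]]].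
  exists (l * m), (l *: (e ** c) + m *: (e ** b) + b ** c); split.
    apply: (subspaceD sB); last exact: BM.
    by apply: (subspaceD sB); apply: (subspaceZ _ sB); apply: Be.
  by rewrite !mulE e_idem (mulC b e); lcomb K A.
Qed.

(** The relation gives [e y = - y^2 / 2] and puts [y^2] in [U]; the rest of [alg(y)] is spanned by
    the null part, also in [U], where [e] acts as 1/2. *)
Lemma idempotent_mul_alg y : w y = 0 -> 2%:R *: (e ** y) + y ** y = 0 ->
  forall x, alg mul y x -> alg mul y (e ** x).
Proof.
move=> wy ey; have [u [v [Uu Vv yE]]] := peirce_decomposition wy.
have U_half x : U x -> e ** x = 2%:R^-1 *: x by move=> {2}<-; rewrite half_scale.
have Uyy : U (y ** y).
  have [EEy _ _ _] := bernstein_components wy.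
  move/eqP: ey; rewrite addrC addr_eq0 => /eqP->; rewrite -scaleN1r.
  by apply: subspaceZ; [exact: peirceU_subspace | exact: EEy].
have eyE : e ** y = - 2%:R^-1 *: (y ** y).
  move/eqP: ey; rewrite addr_eq0 => /eqP/(congr1 (fun x => 2%:R^-1 *: x)).
  by rewrite half_scale scalerN scaleNr.
have s_alg := alg_subspace mul y; have [_ _ algM] := alg_subalgebra mul y.
have y_alg := @mem_alg _ _ mul y; have yy_alg := algM _ _ y_alg y_alg.
move=> x x_alg; move: (x_alg); rewrite {1}yE alg_power_span //.
move=> [c1 [c2 [P]]]; rewrite -yE; set s := horner_op _ _ _ => xE.
have Us : U s by apply: (null_partU Uu Vv); rewrite /s yE; apply: horner_cube_null_part.
rewrite xE !mulDr !mulZr eyE (U_half _ Uyy) (U_half _ Us).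
have ys : alg mul y s.
  rewrite -[s](addKr (c1 *: y + c2 *: (y ** y))) -xE addrC.
  apply: (subspaceB s_alg) => //.
  by apply: (subspaceD s_alg); apply: (subspaceZ _ s_alg).
by do !apply: (subspaceD s_alg); do !apply: (subspaceZ _ s_alg).
Qed.

End PeirceDecomposition.

Lemma alg_sub_lin_span_weight a d : w a != 0 ->
  (forall y, w y = 0 -> exists2 n, (n <= d)%N & has_dim (alg mul y) n) ->
  exists g : 'I_d.+1 -> A, alg mul a `<=` lin_span g.
Proof.
move=> wa dimN; pose b := (w a)^-1 *: a; pose f := b ** b; pose y := b - f.
have wZ k x : w (k *: x) = k * w x by rewrite -[_ *: _]addr0 wP linear0 addr0.
have wb : w b = 1 by rewrite wZ mulVf.
have wf : w f = 1 by rewrite wM wb mulr1.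
have ff : f ** f = f.
  by case: A_bernstein => _ _ /(_ b); rewrite wb expr1n scale1r.
have wy : w y = 0 by rewrite linearB /= wb wf subrr.
have fy : 2%:R *: (f ** y) + y ** y = 0.
  have bb : b ** b = f by [].
  rewrite /y; clear y wy; clearbody f b.
  by rewrite !mulE bb ff (mulC b f); lcomb K A.
have [n le_nd [h [_ alg_h]]] := dimN y wy.
have s_alg := alg_subspace mul y; have [_ _ algM] := alg_subalgebra mul y.
have sB := idempotent_extension_subalgebra ff s_alg algM
  (idempotent_mul_alg ff wf wy fy).
(* Slot 0 holds [f], the next [n] slots a basis of [alg(y)], and zeros fill the rest, so that the
   number of generators does not depend on [a]. *)
exists (fun i : 'I_d.+1 => if unlift ord0 i is Some j then
  (if insub (val j) is Some k then h k else 0) else f).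
set g := (g in lin_span g).
apply: (@subset_trans _ [set x | exists k c, alg mul y c /\ x = k *: f + c]).
  apply: alg_min => //; exists (w a), (w a *: y); split.
    exact: (subspaceZ _ s_alg (@mem_alg _ _ mul y)).
  by rewrite -scalerDr addrC subrK scalerA divff // scale1r.
move=> _ [k [c [+ ->]]]; rewrite alg_h => hc.
have sg := lin_span_subspace g.
apply: (subspaceD sg).
  apply: (subspaceZ _ sg); have := mem_lin_span g ord0.
  by rewrite {2}/g unlift_none.
move: c hc; apply: lin_span_sub => // i.
pose j := widen_ord le_nd i; have := mem_lin_span g (lift ord0 j).
by rewrite {2}/g liftK /= valK.
Qed.

End BernsteinAlgebra.

(** * Equivalence of the three conditions *)

Theorem theorem2p16 (K : fieldType)
    (K_infinite : infinite_set [set: K])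
    (K_char2 : 2%N \notin [pchar K]) (K_char3 : 3%N \notin [pchar K])
    (A : lmodType K) (mul : {bilinear A -> A -> A}) (w : {scalar A})
    (A_bernstein : bernstein mul w)
    (e : A) (e_neq0 : e != 0) (e_idem : mul e e = e) :
  let i := algebraic_bounded mul [set: A] in
  let ii := algebraic_bounded mul (barideal w) in
  let U := peirceU mul e in
  let V := peirceV mul e in
  let iii :=
    (forall v, V v -> algebraic_op_on U (mul v)) /\
    (exists d : nat, forall v, V v ->
       forall n, op_degree_on U (mul v) n -> (n <= d)%N) in
  (i <-> ii) /\ (ii <-> iii).
Proof.
move=> i ii U V iii.
have two_neq0 : 2%:R != 0 :> K by apply: char_neq0.
have we1 := weight_idempotent A_bernstein e_neq0 e_idem.
have sU : subspace U := peirceU_subspace mul e.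
have iiiE : iii <-> exists d, forall v, V v -> exists P : {poly K},
    [/\ P != 0, annihilates_on U (mul v) P & ((size P).-1 <= d)%N].
  have := op_degree_bounded_annihilator U (mul @` V).
  rewrite /iii => -[h1 h2]; split.
    move=> [U_alg [d Ud]]; have [|d' Ud'] := h1.
      split=> [_ [v Vv <-]|]; first exact: U_alg.
      by exists d => _ [v Vv <-]; apply: Ud.
    by exists d' => v Vv; apply: Ud'; exists v.
  move=> [d Ud]; have [|U_alg [d' Ud']] := h2.
    by exists d => _ [v Vv <-]; apply: Ud.
  split=> [v Vv|]; first by apply: U_alg; exists v.
  by exists d' => v Vv; apply: Ud'; exists v.
split; split.
- by move=> [A_alg [d Ad]]; split=> [a _|]; [exact: A_alg | exists d => a _; exact: Ad].
(* The extra dimension accounts for the idempotent adjoined when the weight is nonzero. *)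
- move=> /algebraic_bounded_dim[d dimN]; apply: (@algebraic_bounded_span _ _ _ _ d.+1).
  move=> a _; have [wa|wa] := eqVneq (w a) 0; last first.
    exact: (alg_sub_lin_span_weight K_infinite two_neq0 A_bernstein wa dimN).
  have [n le_nd [h [_ ->]]] := dimN a wa.
  exists (fun i : 'I_d.+1 => if insub (val i) is Some k then h k else 0).
  apply: lin_span_sub => [|j]; first exact: lin_span_subspace.
  set g := (g in lin_span g).
  have := mem_lin_span g (widen_ord (leqW le_nd) j).
  by rewrite {2}/g /= valK.
- move=> /algebraic_bounded_dim[d dimN]; apply/iiiE.
  (* The local degree bound on [U] is [d + d + 2]; passing from local to global annihilators squares
     it. *)
  exists ((d + d + 2) * (d + d + 2))%N => v Vv.
  apply: locally_algebraic_bounded => // [|u Uu|u Uu].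
  + exact: linearP.
  + exact: (peirceVU K_infinite two_neq0 A_bernstein e_idem we1).
  + exact: (peirceV_locally_algebraic K_infinite two_neq0 A_bernstein e_idem we1).
- move=> /iiiE[d Ud]; apply: (@algebraic_bounded_span _ _ _ _ d.+2) => a wa.
  have [u [v [Uu Vv ->]]] :=
    peirce_decomposition K_infinite two_neq0 A_bernstein e_idem we1 wa.
  have [P [P0 PU sP]] := Ud v Vv.
  exact: (alg_sub_lin_span K_infinite two_neq0 A_bernstein e_idem we1 Uu Vv P0 PU).
Qed.
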